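(* Let $H$ be a finite dimensional complex Hilbert space and let $d\ge 1$ be an integer. (1) Let $\alpha:\mathcal{B}(H)\to\mathcal{B}(H)$ be a non-zero completely positive map with a Choi-Kraus decomposition $\alpha(X)=\sum_{i=1}^d L_i^*XL_i$ for all $X\in\mathcal{B}(H)$, where $L_1,\dots,L_d\in\mathcal{B}(H)$. Suppose $\alpha$ is nilpotent of order $p$ and has CP nilpotent type $(a_1,a_2,\dots,a_p)$. Then $$a_{i+1}\le d\,a_i\quad\text{for all } 1\le i\le p-1.$$ (2) Conversely, given a tuple $(a_1,a_2,\dots,a_p)$ of natural numbers (positive integers) with $a_1+a_2+\cdots+a_p=\dim(H)$ and $a_{i+1}\le d\,a_i$ for all $1\le i\le p-1$, there exists a nilpotent completely positive map $\alpha:\mathcal{B}(H)\to\mathcal{B}(H)$ of the form $\alpha(X)=\sum_{k=1}^d L_k^*XL_k$ with $L_1,\dots,L_d\in\mathcal{B}(H)$, which is nilpotent of order $p$ and has CP nilpotent type $(a_1,a_2,\dots,a_p)$.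
   Context: $\mathcal{B}(H)$ is the algebra of all linear maps on $H$ and $1$ denotes its identity. Every completely positive map $\alpha$ on $\mathcal{B}(H)$ has a (non-unique) Choi-Kraus decomposition $\alpha(X)=\sum_{i=1}^d L_i^*XL_i$ with finitely many $L_i\in\mathcal{B}(H)$; the $L_i$ are not required to be linearly independent. A linear map $A$ is nilpotent of order $p\ge 1$ if $A^p=0$ and $p$ is the smallest such number; here $\alpha^k$ is the $k$-fold composition of $\alpha$ with itself. For a completely positive map $\alpha$ on $\mathcal{B}(H)$ that is nilpotent of order $p$, put $H_1=\ker(\alpha(1))$ and $H_k=\ker(\alpha^k(1))\cap(\ker(\alpha^{k-1}(1)))^\perp$ for $2\le k\le p$. Then $H=H_1\oplus\cdots\oplus H_p$, and with $a_i=\dim(H_i)$ the tuple $(a_1,\dots,a_p)$ is called the CP nilpotent type of $\alpha$. *)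

(* Defs.v *)
From HB Require Import structures.
From mathcomp Require Import all_boot all_order all_algebra.
From mathcomp Require Import boolp classical_sets.

Set Implicit Arguments.
Unset Strict Implicit.
Unset Printing Implicit Defensive.

Import Order.TTheory GRing.Theory Num.Theory.

Local Open Scope ring_scope.

(* A finite dimensional Hilbert space over C is a vectType H over C with a
   positive definite Hermitian form dot, linear in its first argument and
   conjugate linear in its second.  B(H) is 'End(H), with identity \1%VF.
   The complex numbers are the instance C := R[i] for a realType R. *)

Section Adjoint.
Variables (C : numClosedFieldType) (H : vectType C) (dot : {dot H for Num.conj}).
Implicit Types (L A : 'End(H)) (u v : H).

Lemma dot_inj u v : (forall w, dot u w = dot v w) -> u = v.
Proof.
move=> uv; apply/eqP; rewrite -subr_eq0 -(dnorm_eq0 dot).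
by rewrite linearBl /= uv subrr.
Qed.

Definition is_adjoint L A := forall u v, dot (L u) v = dot u (A v).

Lemma is_adjoint_exists L : exists A, is_adjoint L A.
Proof.
pose n := \dim {: H}; pose e := vbasis {: H}.
have vE v : v = \sum_(i < n) coord e i v *: e`_i.
  exact: (coord_vbasis (memvf v)).
have rowl (w : 'I_n -> H) :
    linear (fun v => \row_(i < n) dot v (w i) : 'rV[C]_n).
  move=> c u v; apply/rowP => i.
  by rewrite !mxE linearDl linearZl_LR.
pose lin w := GRing.isLinear.Build _ _ _ _ _ (rowl w).
pose rowL w : {linear H -> 'rV[C]_n} :=
  HB.pack (fun v => \row_(i < n) dot v (w i) : 'rV[C]_n) (lin w).
pose T := linfun (rowL (fun i => e`_i)); pose S := linfun (rowL (fun i => L e`_i)).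
have TE w i : T w 0 i = dot w e`_i by rewrite lfunE /= mxE.
have SE w i : S w 0 i = dot w (L e`_i) by rewrite lfunE /= mxE.
have kT : lker T == 0%VS.
  apply/lker0P => u v uv; apply: dot_inj => w.
  rewrite [w]vE !linear_sumr; apply: eq_bigr => i _.
  by rewrite !linearZr_LR /= -!TE uv.
have surjT y : y \in limg T.
  have -> : limg T = {: 'rV[C]_n}%VS; last exact: memvf.
  apply/eqP; rewrite eqEdim subvf limg_dim_eq ?(eqP kT) ?capv0 //.
  by rewrite [X in (X <= _)%N]dimvf dim_matrix; apply: eq_leq; exact: mul1n.
exists (T^-1 \o S)%VF => u v.
have D (i : 'I_n) : dot (L e`_i) v = dot e`_i ((T^-1 \o S)%VF v).
  have dotC x y : dot x y = Num.conj (dot y x) by rewrite hermC expr0 mul1r.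
  by rewrite comp_lfunE dotC [RHS]dotC -SE -TE limg_lfunVK.
rewrite [u]vE linear_sum !linear_sumlz; apply: eq_bigr => i _ /=.
rewrite (linearZ_LR L) !linearZl_LR; congr (_ * _); exact: D.
Qed.

Definition adjoint L : 'End(H) := xget 0 [set A | is_adjoint L A]%classic.

Lemma adjointP L u v : dot (L u) v = dot u (adjoint L v).
Proof.
have [A LA] := is_adjoint_exists L.
by have := @xgetPex _ 0 [set A | is_adjoint L A]%classic (ex_intro _ A LA); apply.
Qed.

End Adjoint.

Section CPMaps.
Variables (C : numClosedFieldType) (H : vectType C) (dot : {dot H for Num.conj}).
Implicit Type alpha : {linear 'End(H) -> 'End(H)}.

(* Positivity of a matrix X of M_m(B(H)) as an operator on the direct sum H^m,
   (X h)_i = \sum_j X_ij h_j.  The order on C makes 0 <= z mean that z is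
   real and nonnegative. *)
Definition positive_block m (X : 'I_m -> 'I_m -> 'End(H)) : Prop :=
  forall h : 'I_m -> H, 0 <= \sum_(i < m) \sum_(j < m) dot (X i j (h j)) (h i).

Definition completely_positive alpha : Prop :=
  forall m (X : 'I_m -> 'I_m -> 'End(H)),
    positive_block X -> positive_block (fun i j => alpha (X i j)).

Definition choi_kraus alpha d (L : 'I_d -> 'End(H)) : Prop :=
  forall X : 'End(H),
    alpha X = \sum_(i < d) (adjoint dot (L i) \o X \o L i)%VF.

Definition nilpotent_of_order alpha (p : nat) : Prop :=
  [/\ (0 < p)%N,
      forall X, iter p alpha X = 0 &
      forall k, (0 < k < p)%N -> exists X, iter k alpha X != 0].

(* The subspace H_k, for 1 <= k <= p. *)
Definition nilspace alpha (k : nat) : {vspace H} :=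
  if k == 1%N then lker (alpha \1%VF)
  else (lker (iter k alpha \1%VF) :&:
        orthov dot (lker (iter k.-1 alpha \1%VF)))%VS.

(* The entry a_k of the type is tnth a at index k - 1. *)
Definition has_cp_nilpotent_type alpha p (a : p.-tuple nat) : Prop :=
  nilpotent_of_order alpha p /\
  forall i : 'I_p, tnth a i = \dim (nilspace alpha i.+1).

End CPMaps.

(* Main.v *)
From HB Require Import structures.
Require Import Defs.
From mathcomp Require Import all_boot all_order all_algebra.
From mathcomp Require Import complex.
From mathcomp Require Import boolp classical_sets reals.
From mathcomp Require Import zify.

(** Let K_k be the kernel of alpha^k(1).  Since <alpha^(k+1)(1) u, u> is the sum
    over i of <alpha^k(1) (L_i u), L_i u>, all terms being nonnegative, K_(k+1)
    is the intersection of the preimages of K_k under the L_i.  As H_(k+1) is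
    the orthogonal complement of K_k in K_(k+1), the map u |-> (L_i u)_i embeds
    K_(k+2) / K_(k+1) into d copies of K_(k+1) / K_k, which gives (1).

    For (2), split a basis into levels of sizes a_1, ..., a_p and give each
    vector of level k at most d children in level k+1, so that every vector of
    level > 1 is a child; let L_i send a vector to its parent if it is an i-th
    child, and to 0 otherwise.  Then K_k is spanned by the first k levels.  The
    basis need not be orthonormal, because the recursion for K_k does not
    involve the inner product. *)

Set Implicit Arguments.
Unset Strict Implicit.

Import Order.TTheory GRing.Theory Num.Theory.

Local Open Scope ring_scope.
Local Open Scope complex_scope.

(** * Dimension counts for preimages of subspaces *)

(** The map [f] induces an injection of [U / (U :&: f @^-1: V)] into [W / V]. The count comes from
    rank-nullity on [U] and on [U'], where [f] has the same kernel. *)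
Lemma dim_cap_preim (K : fieldType) (H : vectType K) (f : 'End(H))
    (U V W : {vspace H}) :
  (f @: U <= W)%VS -> (V <= W)%VS ->
  (\dim U + \dim V <= \dim (U :&: f @^-1: V) + \dim W)%N.
Proof.
move=> fUW VW; set U' := (U :&: f @^-1: V)%VS.
have sumW : (\dim (f @: U + V) <= \dim W)%N.
  by apply: dimvS; rewrite subv_add fUW.
have capU' : (\dim (f @: U :&: V) <= \dim (f @: U'))%N.
  apply: dimvS; apply/subvP => w /memv_capP[/memv_imgP[u uU ->] fuV].
  by rewrite memv_img // memv_cap uU -memv_preim.
have kerU' : (\dim (U :&: lker f) <= \dim (U' :&: lker f))%N.
  apply: dimvS; apply/subvP => u /memv_capP[uU kfu].
  rewrite !memv_cap uU kfu -memv_preim andbT /=.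
  by move: kfu; rewrite memv_ker => /eqP->; rewrite mem0v.
have := dimv_sum_cap (f @: U) V.
have := limg_ker_dim f U; have := limg_ker_dim f U'.
lia.
Qed.

(** The bound for one operator is applied to successive intersections: each preimage costs at most
    [\dim W - \dim V], whatever subspace of [U] has been reached. *)
Lemma dim_bigcap_preim (K : fieldType) (H : vectType K) (I : Type) (r : seq I)
    (f : I -> 'End(H)) (U V W : {vspace H}) :
  (forall i, (f i @: U <= W)%VS) -> (V <= W)%VS ->
  (\dim U <= \dim (U :&: \bigcap_(i <- r) (f i @^-1: V)) +
             size r * (\dim W - \dim V))%N.
Proof.
move=> + VW; elim: r U => [|i r IH] U fU; first by rewrite big_nil capvf addn0.
have := dim_cap_preim (fU i) VW.
have /IH : forall j, (f j @: (U :&: f i @^-1: V) <= W)%VS.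
  by move=> j; apply: subv_trans (fU j); apply: limgS; apply: capvSl.
have := dimvS VW.
rewrite big_cons capvA mulSn -/(size r); lia.
Qed.

(** * Relative orthogonal complements *)

Section Orthogonal.
Variables (C : numClosedFieldType) (H : vectType C) (dot : {dot H for Num.conj}).

Lemma dim_cap_orthov (U V : {vspace H}) :
  (V <= U)%VS -> \dim (U :&: orthov dot V)%VS = (\dim U - \dim V)%N.
Proof.
move=> VU; apply/eqP; rewrite eqn_leq; apply/andP; split.
  have VV0 : (V :&: (U :&: orthov dot V) = 0)%VS.
    apply/eqP; rewrite -subv0; apply/subvP => v /memv_capP[vV /memv_capP[_ vVo]].
    by rewrite memv0 -(dnorm_eq0 dot) (mem_orthovP vVo).
  rewrite -(leq_add2r (\dim V)) subnK ?dimvS // addnC -dimv_disjoint_sum //.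
  by apply: dimvS; rewrite subv_add VU capvSl.
rewrite leq_subLR /orthov.
(* The complement of [V] is cut out by one linear condition per basis vector, and each condition
   lowers the dimension by at most one. *)
elim: (\dim V) (vbasis V : seq H) => [|m IH] e.
  by rewrite big_ord0 capvf.
rewrite big_ord_recr /= capvA -orthov1E.
apply: leq_trans (IH e) _; rewrite addSn -addnS leq_add2l.
apply: leq_trans (leqSpred _) _; exact: (@leq_dim_orthov1 _ _ _ _ dot).
Qed.

End Orthogonal.

(** * The kernel chain of a Choi-Kraus map and the growth bound *)

Section ChoiKraus.
Variables (C : numClosedFieldType) (H : vectType C) (dot : {dot H for Num.conj}).
Variable (d : nat).
Implicit Types (alpha : {linear 'End(H) -> 'End(H)}) (L : 'I_d -> 'End(H)).

Lemma adjoint_dot (A : 'End(H)) u v : dot (adjoint dot A u) v = dot u (A v).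
Proof.
have dotC x y : dot x y = Num.conj (dot y x) by rewrite hermC expr0 mul1r.
by rewrite dotC [RHS]dotC adjointP.
Qed.

Lemma choi_kraus_exists L : exists alpha, choi_kraus dot alpha L.
Proof.
pose f (X : 'End(H)) := \sum_(i < d) (adjoint dot (L i) \o X \o L i)%VF.
have linf : linear f.
  move=> c X Y; rewrite /f scaler_sumr -big_split /=; apply: eq_bigr => i _.
  by rewrite comp_lfunDr comp_lfunDl -comp_lfunZr -comp_lfunZl.
pose linI := GRing.isLinear.Build _ _ _ _ _ linf.
pose alpha : {linear 'End(H) -> 'End(H)} := HB.pack f linI.
by exists alpha.
Qed.

Lemma choi_kraus_dot alpha L X u v : choi_kraus dot alpha L ->
  dot (alpha X u) v = \sum_(i < d) dot (X (L i u)) (L i v).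
Proof.
move=> ->; rewrite sum_lfunE linear_sumlz; apply: eq_bigr => i _ /=.
by rewrite !comp_lfunE adjoint_dot.
Qed.

(** Each Kraus index contributes the block form of [X] at the vectors [L k (h i)]. *)
Lemma choi_kraus_cp alpha L : choi_kraus dot alpha L -> completely_positive dot alpha.
Proof.
move=> aL m X X_ge0 h.
under eq_bigr do under eq_bigr do rewrite (choi_kraus_dot _ _ _ aL).
under eq_bigr do rewrite exchange_big /=.
rewrite exchange_big /=; apply: sumr_ge0 => k _.
exact: X_ge0 (fun i => L k (h i)).
Qed.

Definition cp_ker alpha k : {vspace H} := lker (iter k alpha \1%VF).

Lemma cp_ker0 alpha : cp_ker alpha 0 = 0%VS.
Proof. by apply/eqP/lker0P => u v; rewrite !id_lfunE. Qed.

(** Starting the chain at [cp_ker alpha 0], which is zero, removes the special case of the first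
    subspace. *)
Lemma nilspaceS alpha k :
  nilspace dot alpha k.+1 = (cp_ker alpha k.+1 :&: orthov dot (cp_ker alpha k))%VS.
Proof.
case: k => [|k]; rewrite /nilspace //=.
by rewrite cp_ker0 orthov0 capvf.
Qed.

Section Iterates.
Variables (alpha : {linear 'End(H) -> 'End(H)}) (L : 'I_d -> 'End(H)).
Hypothesis alphaL : choi_kraus dot alpha L.

Lemma iter_choi_kraus_eq0 k X u :
  (forall i, iter k alpha X (L i u) = 0) -> iter k.+1 alpha X u = 0.
Proof.
move=> Lu; rewrite iterS alphaL sum_lfunE big1 // => i _.
by rewrite !comp_lfunE Lu linear0.
Qed.

(** Positivity and its equality case go through one induction: if a sum of nonnegative terms is
    zero, every [L i u] lies in the previous kernel, so the next iterate kills [u]. *)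
Lemma iter_id_ge0 k u :
  0 <= dot (iter k alpha \1%VF u) u ?= iff (u \in cp_ker alpha k).
Proof.
apply/leifP; rewrite memv_ker; elim: k u => [|k IH] u.
  by rewrite /= id_lfunE; case: eqVneq => [->|]; rewrite ?linear0r ?dnorm_gt0.
have ge0 v : 0 <= dot (iter k alpha \1%VF v) v.
  by move: (IH v); case: ifP => [_ /eqP ->|_ /ltW].
case: ifP => [/eqP->|/negbT nz]; first by rewrite linear0l.
rewrite lt_def iterS (choi_kraus_dot _ _ _ alphaL) sumr_ge0 ?andbT //.
apply: contra nz; rewrite psumr_eq0 // => /allP Lu0.
apply/eqP/iter_choi_kraus_eq0 => i.
have := Lu0 i (mem_index_enum _); move: (IH (L i u)).
by case: ifP => [/eqP //|_ /gt_eqF->].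
Qed.

Lemma cp_kerS k u : (u \in cp_ker alpha k.+1) = [forall i, L i u \in cp_ker alpha k].
Proof.
apply/idP/forallP => [uK i|Lu]; last first.
  rewrite memv_ker; apply/eqP/iter_choi_kraus_eq0 => i.
  by move: (Lu i); rewrite memv_ker => /eqP.
move: uK; rewrite -(iter_id_ge0 k.+1) iterS (choi_kraus_dot _ _ _ alphaL).
rewrite eq_sym psumr_eq0 => [/allP/(_ i (mem_index_enum _))|j _].
  by rewrite /= eq_sym iter_id_ge0.
by case: (iter_id_ge0 k (L j u)).
Qed.

Lemma cp_kerS_bigcap k :
  cp_ker alpha k.+1 = (\bigcap_(i < d) (L i @^-1: cp_ker alpha k))%VS.
Proof.
apply/vspaceP => u; rewrite cp_kerS.
apply/forallP/idP => [Lu|/subv_bigcapP uL i].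
  by rewrite memvE; apply/subv_bigcapP => i _; rewrite -memvE -memv_preim.
by rewrite memv_preim memvE uL.
Qed.

Lemma cp_ker_subS k : (cp_ker alpha k <= cp_ker alpha k.+1)%VS.
Proof.
elim: k => [|k IH]; first by rewrite cp_ker0 sub0v.
apply/subvP => u; rewrite !cp_kerS => /forallP Lu; apply/forallP => i.
exact: (subvP IH).
Qed.

Lemma dim_nilspaceS k :
  \dim (nilspace dot alpha k.+1) = (\dim (cp_ker alpha k.+1) - \dim (cp_ker alpha k))%N.
Proof. by rewrite nilspaceS dim_cap_orthov // cp_ker_subS. Qed.

Lemma dim_nilspace_growth k :
  (\dim (nilspace dot alpha k.+2) <= d * \dim (nilspace dot alpha k.+1))%N.
Proof.
rewrite !dim_nilspaceS leq_subLR.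
have LK i : (L i @: cp_ker alpha k.+2 <= cp_ker alpha k.+1)%VS.
  by apply/subvP => _ /memv_imgP[u + ->]; rewrite cp_kerS => /forallP.
(* Here [U], [W], [V] are the kernels of index [k.+2], [k.+1], [k], and the intersection of the
   preimages of [V] is [W] again. *)
have := dim_bigcap_preim (enum 'I_d) LK (cp_ker_subS k).
by rewrite big_enum /= -cp_kerS_bigcap (capv_idPr (cp_ker_subS _)) size_enum_ord.
Qed.

Lemma cp_type_growth p (a : p.-tuple nat) i :
  has_cp_nilpotent_type dot alpha a -> (i.+1 < p)%N ->
  (nth 0%N a i.+1 <= d * nth 0%N a i)%N.
Proof.
move=> [_ aE] ip; have := dim_nilspace_growth i.
by rewrite -(aE (Ordinal ip)) -(aE (Ordinal (ltnW ip))) !(tnth_nth 0%N).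
Qed.

(** This reduces nilpotency to the kernel chain: once the [k]-th kernel is all of [H], the [k]-th
    iterate vanishes on every operator. *)
Lemma iter_cp_ker_eq0 k X u : u \in cp_ker alpha k -> iter k alpha X u = 0.
Proof.
elim: k u => [|k IH] u; first by rewrite cp_ker0 memv0 => /eqP->; rewrite linear0.
rewrite cp_kerS => /forallP Lu.
by apply: iter_choi_kraus_eq0 => i; rewrite IH.
Qed.

End Iterates.
End ChoiKraus.

(** * Coordinates in a basis indexed by a finite type *)

Section IndexedBasis.
Variables (K : fieldType) (H : vectType K) (T : finType).
Hypothesis cardT : #|T| = \dim {: H}.

Definition bidx (t : T) : 'I_(\dim {: H}) := cast_ord cardT (enum_rank t).
Definition bvec t : H := (vbasis {: H})`_(bidx t).
Definition bcoord t (u : H) : K := coord (vbasis {: H}) (bidx t) u.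

Lemma bidx_bij : bijective bidx.
Proof.
exists (fun i => enum_val (cast_ord (esym cardT) i)) => [t|i].
  by rewrite /bidx cast_ordK enum_rankK.
by rewrite /bidx enum_valK cast_ordKV.
Qed.

Lemma bcoord_sum u : u = \sum_t bcoord t u *: bvec t.
Proof.
rewrite {1}(coord_vbasis (memvf u)) (reindex bidx) //.
exact: onW_bij bidx_bij.
Qed.

Lemma bcoord_bvec s t : bcoord s (bvec t) = (s == t)%:R.
Proof.
have bfree := basis_free (vbasisP {: H}).
by rewrite /bcoord coord_free // (inj_eq (bij_inj bidx_bij)) eq_sym.
Qed.

Lemma bcoord_sum_bvec s (c : T -> K) : bcoord s (\sum_t c t *: bvec t) = c s.
Proof.
rewrite {1}/bcoord linear_sum (bigD1 s) //= big1 ?addr0 => [|t ts].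
  by rewrite linearZ /= -/(bcoord s _) bcoord_bvec eqxx mulr1.
by rewrite linearZ /= -/(bcoord s _) bcoord_bvec eq_sym (negPf ts) mulr0.
Qed.

Lemma bcoord_eq0 u : (u == 0) = [forall t, bcoord t u == 0].
Proof.
apply/eqP/forallP => [->|u0]; first by move=> t; rewrite /bcoord linear0.
by rewrite (bcoord_sum u) big1 // => t _; rewrite (eqP (u0 t)) scale0r.
Qed.

(** [U] is the span of the [bvec t] with [t] in [P]. This span and the one for the complement of [P]
    together fill [H], so neither dimension can fall below its number of generators. *)
Lemma dim_coord_subspace (P : pred T) (U : {vspace H}) :
  (forall u, (u \in U) = [forall t, P t || (bcoord t u == 0)]) -> \dim U = #|P|.
Proof.
move=> UP; pose S (Q : pred T) := <<[seq bvec t | t in Q]>>%VS.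
have dim_S Q : (\dim (S Q) <= #|Q|)%N.
  by apply: leq_trans (dim_span _) _; rewrite size_map -cardE.
have memS (Q : pred T) u : \sum_(t | Q t) bcoord t u *: bvec t \in S Q.
  apply: memv_suml => t Qt; apply/memvZ/memv_span/map_f.
  by rewrite mem_enum.
have US : (U <= S P)%VS.
  apply/subvP => u; rewrite UP => /forallP u0.
  rewrite (bcoord_sum u) (bigID P) /= [X in _ + X]big1 ?addr0 ?memS // => t Pt.
  by move: (u0 t); rewrite (negPf Pt) => /eqP->; rewrite scale0r.
have SU : (S P <= U)%VS.
  apply/span_subvP => _ /mapP[t + ->]; rewrite mem_enum => Pt.
  rewrite UP; apply/forallP => s; case: (eqVneq s t) => [->|st].
    by rewrite [P t]Pt.
  by rewrite bcoord_bvec (negPf st) eqxx orbT.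
have full : ({: H} <= S P + S (predC P))%VS.
  apply/subvP => u _; rewrite (bcoord_sum u) (bigID P) /=.
  exact: memv_add (memS _ _) (memS _ _).
apply/eqP; rewrite eqn_leq (leq_trans (dimvS US)) //=.
rewrite -(leq_add2r #|predC P|) cardC cardT.
apply: leq_trans (dimvS full) _; apply: leq_trans (dimv_add_leqif _ _).1 _.
by rewrite leq_add ?dimvS.
Qed.

(** On the basis, [L] sends [bvec s] to the sum of the [bvec t] with [f t = Some s]. *)
Lemma coord_pullback_exists (f : T -> option T) :
  exists L : 'End(H), forall t u, bcoord t (L u) = oapp (bcoord ^~ u) 0 (f t).
Proof.
pose g u := \sum_t oapp (bcoord ^~ u) 0 (f t) *: bvec t.
have ling : linear g.
  move=> c u v; rewrite /g scaler_sumr -big_split /=; apply: eq_bigr => t _.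
  case: (f t) => [s|] /=; last by rewrite !scale0r scaler0 addr0.
  by rewrite /bcoord linearP scalerDl scalerA.
pose G : {linear H -> H} := HB.pack g (GRing.isLinear.Build _ _ _ _ _ ling).
by exists (linfun G) => t u; rewrite lfunE /= bcoord_sum_bvec.
Qed.

End IndexedBasis.

(** * The forest of basis vectors realizing a given type *)

Section Converse.
Variables (C : numClosedFieldType) (H : vectType C) (dot : {dot H for Num.conj}).
Variables (d p : nat) (a : p.-tuple nat).
Hypothesis d_gt0 : (0 < d)%N.
Hypothesis a_growth : forall i : nat, (i.+1 < p)%N ->
  (nth 0%N a i.+1 <= d * nth 0%N a i)%N.

(* Levels are numbered from 0 here: level k has size a_(k+1). *)
Definition node := {k : 'I_p & 'I_(tnth a k)}.

(** The children of number [x] in a level are the numbers [x * d + i] with [i < d] that exist in the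
    next level. *)
Definition is_child (i : 'I_d) (t s : node) : bool :=
  (tag s == (tag t).+1 :> nat) && (tagged s == tagged t * d + i :> nat)%N.

Lemma is_child_inj i t s s' : is_child i t s -> is_child i t s' -> s = s'.
Proof.
case: s s' => [k x] [k' x'] /andP[/= /eqP k1 /eqP x1] /andP[/= /eqP k2 /eqP x2].
have kk' : k = k' by apply: ord_inj; rewrite k1 k2.
subst k'; congr existT; apply: ord_inj; by rewrite x1 x2.
Qed.

Lemma is_child_surj (s : node) : (0 < tag s)%N ->
  exists (i : 'I_d) (t : node), [/\ (tag t).+1 = tag s :> nat & is_child i t s].
Proof.
case: s => -[[|k] kp] x //= _.
(* The parent of number [x] is [x %/ d], as its child of index [x %% d]; the growth hypothesis puts
   this quotient in range. *)
have x_lt : (x %/ d < tnth a (Ordinal (ltnW kp)))%N.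
  rewrite ltn_divLR // mulnC; apply: leq_trans (ltn_ord x) _.
  by rewrite !(tnth_nth 0%N) a_growth.
exists (Ordinal (ltn_pmod x d_gt0)).
exists (Tagged (fun k => 'I_(tnth a k)) (Ordinal x_lt)); split => //.
by rewrite /is_child /= eqxx -divn_eq eqxx.
Qed.

Lemma card_node : #|{: node}| = (\sum_(i < p) tnth a i)%N.
Proof.
rewrite card_tagged sumnE big_map big_enum.
by apply: eq_bigr => i _; rewrite card_ord.
Qed.

Lemma card_node_level (i : 'I_p) : #|[pred t : node | tag t == i]| = tnth a i.
Proof.
transitivity (\sum_(k | k == i) \sum_(j < tnth a k) 1)%N; last first.
  by rewrite big_pred1_eq sum1_card card_ord.
by rewrite sig_big_dep -sum1_card; apply: eq_bigl => t; rewrite andbT.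
Qed.

Lemma card_node_lt (i : 'I_p) :
  #|[pred t : node | (tag t < i.+1)%N]| =
  (#|[pred t : node | (tag t < i)%N]| + tnth a i)%N.
Proof.
rewrite -(cardID [pred t : node | (tag t < i)%N]); congr (_ + _)%N.
  by apply: eq_card => t; rewrite !inE ltnS; case: ltngtP.
rewrite -card_node_level; apply: eq_card => t; rewrite !inE ltnS -leqNgt.
by rewrite -eqn_leq eq_sym.
Qed.

Lemma cp_type_exists :
  (forall i : 'I_p, (0 < tnth a i)%N) -> (0 < p)%N ->
  (\sum_(i < p) tnth a i)%N = \dim {: H} ->
  exists (alpha : {linear 'End(H) -> 'End(H)}) (L : 'I_d -> 'End(H)),
    choi_kraus dot alpha L /\ has_cp_nilpotent_type dot alpha a.
Proof.
move=> a_gt0 p_gt0 dimH; have cardT := etrans card_node dimH.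
have /choice[L LE] (i : 'I_d) :=
  coord_pullback_exists cardT (fun t => [pick s | is_child i t s]).
have [alpha aL] := choi_kraus_exists dot L.
exists alpha, L; split=> //.
(* The [k]-th kernel consists of the vectors supported on the first [k] levels. *)
have memK k u : (u \in cp_ker alpha k) =
    [forall t : node, (tag t < k)%N || (bcoord cardT t u == 0)].
  elim: k u => [|k IH] u.
    by rewrite cp_ker0 memv0 (bcoord_eq0 cardT).
  rewrite (cp_kerS aL); apply/forallP/forallP => [Lu s|u0 i].
    case: ltnP => //= ks.
    (* The coordinate of [u] at [s] is the coordinate of [L i u] at the parent [t], which lies at
       level [k] or beyond. *)
    have [i [t [ts its]]] := is_child_surj (leq_trans (ltn0Sn k) ks).
    move: (Lu i); rewrite IH => /forallP/(_ t); rewrite LE.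
    rewrite -ltnS ts ltnNge ks /=; case: pickP => [s' /= its'|/(_ s)].
      by rewrite (is_child_inj its its').
    by rewrite its.
  rewrite IH; apply/forallP => t; rewrite LE; case: pickP => [s|_] /=.
    by case/andP=> /eqP ts _; move: (u0 s); rewrite ts ltnS.
  by rewrite eqxx orbT.
have dimK k : \dim (cp_ker alpha k) = #|[pred t : node | (tag t < k)%N]|.
  exact: dim_coord_subspace (memK k).
split; last first.
  by move=> i; rewrite (dim_nilspaceS aL) !dimK card_node_lt addKn.
split=> // [X|k /andP[_ kp]].
  apply/lfunP => u; rewrite zero_lfunE (iter_cp_ker_eq0 aL) //.
  by rewrite memK; apply/forallP => t; rewrite ltn_ord.
(* The order is exactly [p]: for [k < p], level [k] is nonempty, and its first basis vector is
   outside the [k]-th kernel. *)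
exists \1%VF; apply/eqP => ak0.
pose t : node := Tagged (fun k => 'I_(tnth a k)) (Ordinal (a_gt0 (Ordinal kp))).
have : bvec cardT t \in cp_ker alpha k by rewrite memv_ker ak0 zero_lfunE.
by rewrite memK => /forallP/(_ t); rewrite ltnn bcoord_bvec eqxx oner_eq0.
Qed.

End Converse.

Unset Implicit Arguments.
Set Strict Implicit.

Theorem theorem2p4 (R : realType) (H : vectType R[i])
    (dot : {dot H for Num.conj}) (d : nat) (d_ge1 : (1 <= d)%N) :
  (forall (alpha : {linear 'End(H) -> 'End(H)}) (L : 'I_d -> 'End(H))
      (p : nat) (a : p.-tuple nat),
    completely_positive dot alpha ->
    (exists X, alpha X != 0) ->
    choi_kraus dot alpha L ->
    nilpotent_of_order alpha p ->
    has_cp_nilpotent_type dot alpha a ->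
    forall i : nat, (i.+1 < p)%N ->
      (nth 0%N a i.+1 <= d * nth 0%N a i)%N)
  /\
  (forall (p : nat) (a : p.-tuple nat),
    (1 <= p)%N ->
    (forall i : 'I_p, (0 < tnth a i)%N) ->
    (\sum_(i < p) tnth a i)%N = \dim {: H} ->
    (forall i : nat, (i.+1 < p)%N ->
      (nth 0%N a i.+1 <= d * nth 0%N a i)%N) ->
    exists (alpha : {linear 'End(H) -> 'End(H)}) (L : 'I_d -> 'End(H)),
      [/\ completely_positive dot alpha,
          choi_kraus dot alpha L,
          nilpotent_of_order alpha p &
          has_cp_nilpotent_type dot alpha a]).
Proof.
split=> [alpha L p a _ _ aL _ aT i|p a p_gt0 a_gt0 dimH a_growth].
  exact: cp_type_growth aL _ _ _ aT.
have [alpha [L [aL aT]]] := cp_type_exists dot d_ge1 a_growth a_gt0 p_gt0 dimH.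
exists alpha, L; split=> //; [exact: choi_kraus_cp aL|exact: aT.1].
Qed.
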